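(* Let $K\in\mathbb{N}_0$, let $m_0=1$ and $m_k=2$ for $k\ge1$, and for $k=0,\ldots,K$ let $g_k:\mathbb{R}^{m_k}\times E\to\mathbb{R}$ be measurable functions bounded on compact sets, such that the map $x\mapsto g_k(r_k,x)$ is bounded on $E$ for every $r_k\in\mathbb{R}^{m_k}$. For $x\in E$ and $Z\in b\mathcal{F}$ define $$R_k^x(Z)=\begin{cases}\mathbb{E}^x[g_0(Z,X_0)],&k=0,\\ \mathbb{E}^x\big[g_k\big(Z,R_{k-1}^{X_0}(Z),X_0\big)\big],&1\le k\le K,\end{cases}$$ and, for $t\ge1$, $$R_k^x(Z\vert\mathcal{F}_t)=\begin{cases}\mathbb{E}^x[g_0(Z,X_t)\,\vert\,\mathcal{F}_t],&k=0,\\ \mathbb{E}^x\big[g_k\big(Z,R_{k-1}^x(Z\vert\mathcal{F}_t),X_t\big)\,\big\vert\,\mathcal{F}_t\big],&1\le k\le K.\end{cases}$$ Assume that for each $x\in E$ the sequence $(\rho_t^x)_{t\in\mathbb{N}_0}$ given by $\rho_0^x(Z)=R_K^x(Z)$ and $\rho_t^x(Z)=R_K^x(Z\vert\mathcal{F}_t)$ for $t\ge1$ is a dynamic conditional risk mapping. Then the family $\varrho=((\rho_t^x)_{t\in\mathbb{N}_0})_{x\in E}$ satisfies the Markov property.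
   Context: Setting. $E$ is a Polish space with Borel $\sigma$-algebra $\mathcal{E}$; $\mathbb{N}_0=\{0,1,2,\ldots\}$; $\Omega=E^{\mathbb{N}_0}$; $X_t(\omega)=\omega(t)$ is the coordinate process; $\mathcal{F}_t=\sigma(X_s: s\le t)$ and $\mathcal{F}=\sigma(\bigcup_t\mathcal{F}_t)$. $X$ is a time-homogeneous Markov chain; $x\mapsto\mathbb{P}^x$ is a measurable map from $E$ to the probability measures on $(\Omega,\mathcal{F})$, where $\mathbb{P}^x$ is the law of the chain started at $x$ (so $\mathbb{P}^x(X_0=x)=1$), and $\mathbb{E}^x$ is expectation under $\mathbb{P}^x$. The shifts $\theta_t:\Omega\to\Omega$ satisfy $X_s\circ\theta_t=X_{t+s}$. $b\mathcal{G}$ denotes the bounded $\mathcal{G}$-measurable real random variables. Risk mapping on $(\Omega,\mathcal{F},\mathbb{P}^x)$: a function $\rho^x:b\mathcal{F}\to\mathbb{R}$ with $\rho^x(0)=0$; $\rho^x(Z+c)=c+\rho^x(Z)$ for $Z\in b\mathcal{F}$, $c\in\mathbb{R}$; and $Z\le Z'$ $\mathbb{P}^x$-a.s. implies $\rho^x(Z)\le\rho^x(Z')$. Conditional risk mapping on $(\Omega,\mathcal{F},\mathbb{P}^x)$ with respect to $\mathcal{F}_t$: a function $\rho^x_t:b\mathcal{F}\to b\mathcal{F}_t$ with $\rho_t^x(0)=0$ $\mathbb{P}^x$-a.s.; $\rho_t^x(Z+Z')=Z'+\rho_t^x(Z)$ $\mathbb{P}^x$-a.s. for $Z\in b\mathcal{F}$,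 $Z'\in b\mathcal{F}_t$; and $Z\le Z'$ $\mathbb{P}^x$-a.s. implies $\rho_t^x(Z)\le\rho_t^x(Z')$ $\mathbb{P}^x$-a.s. Dynamic conditional risk mapping on $(\Omega,\mathcal{F},(\mathcal{F}_t),\mathbb{P}^x)$: a sequence $(\rho_t^x)_{t\in\mathbb{N}_0}$ where $\rho_0^x$ is a risk mapping and, for $t\ge1$, $\rho_t^x$ is a conditional risk mapping with respect to $\mathcal{F}_t$. Write $\rho^x:=\rho_0^x$. Regularity: $(\rho^x)_{x\in E}$ is regular if for all $Z\in b\mathcal{F}$ the map $x\mapsto\rho^x(Z)$ is bounded and measurable. Markov property: a family $\varrho=((\rho_t^x)_{t\in\mathbb{N}_0})_{x\in E}$ of dynamic conditional risk mappings satisfies the Markov property (is Markovian) if $(\rho^x_0)_{x\in E}$ is regular and for each $x\in E$, $Z\in b\mathcal{F}$, $t\in\mathbb{N}_0$: $\rho_t^x(Z\circ\theta_t)=\rho^{X_t}(Z)$ $\mathbb{P}^x$-a.s., where $\rho^{X_t}(Z)$ is $\omega\mapsto\rho^{X_t(\omega)}(Z)$. *)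

(* Defs.v *)
From HB Require Import structures.
From mathcomp Require Import all_boot all_order all_algebra.
From mathcomp Require Import all_classical all_reals all_analysis.

Set Implicit Arguments.
Unset Strict Implicit.
Unset Printing Implicit Defensive.

Import Order.TTheory GRing.Theory Num.Theory.
Import numFieldNormedType.Exports.

Local Open Scope classical_set_scope.
Local Open Scope ring_scope.

(* [completePseudoMetricType] and [hausdorff_space] together give a complete
   metric space. *)
Definition polish (R : realType) (E : topologicalType) : Prop :=
  (exists2 D : set E, countable D & dense D) /\
  exists (M : completePseudoMetricType R) (f : E -> M) (g : M -> E),
    [/\ hausdorff_space M, cancel f g, cancel g f, continuous f &
        continuous g].

Definition borel (E : ptopologicalType) : measurableType _ :=
  g_sigma_algebraType (@open E).

Section path_space.
Variable E : ptopologicalType.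

Definition coord (t : nat) (w : nat -> E) : E := w t.

Definition shift (t : nat) (w : nat -> E) : nat -> E := fun s => w (t + s)%N.

Definition filtration (t : nat) : set (set (nat -> E)) :=
  <<s \bigcup_(s in [set s | (s <= t)%N])
        preimage_set_system setT (coord s) (@measurable _ (borel E)) >>.

Definition Omega : measurableType _ :=
  g_sigma_algebraType (\bigcup_t filtration t).

End path_space.
Arguments filtration : clear implicits.

Section measurability_wrt.
Context {R : realType} {T : Type}.

Definition measurable_wrt (G : set (set T)) (Z : T -> R) : Prop :=
  preimage_set_system setT Z measurable `<=` G.

Definition bmeas (G : set (set T)) : set (T -> R) :=
  [set Z | measurable_wrt G Z /\ bounded_fun Z].

End measurability_wrt.

Notation bF R E := (@bmeas R (Omega E) (@measurable _ (Omega E))).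
Notation bF_ R E t := (@bmeas R (Omega E) (filtration E t)).

Section conditional_expectation.
Context d {T : measurableType d} {R : realType}.
Variables (P : probability T R) (G : set (set T)).

Definition is_cexp_ge0 (W Y : T -> R) : Prop :=
  [/\ forall w, 0 <= Y w,
      measurable_wrt G Y &
      forall A, G A ->
        (\int[P]_(w in A) (W w)%:E = \int[P]_(w in A) (Y w)%:E)%E].

(* [Y] is a version of E[W | G], defined as E[W^+ | G] - E[W^- | G] whenever
   both terms are almost surely finite.  This agrees with the usual definition
   when [W] is integrable, but does not require integrability: the iterated
   g_k(Z, ..., X_t) need not be integrable, since g_k is only bounded on
   compact sets while X_t ranges over all of E. *)
Definition is_cexp (W Y : T -> R) : Prop :=
  measurable_wrt G Y /\
  exists Yp Yn : T -> R,
    [/\ is_cexp_ge0 W^\+ Yp, is_cexp_ge0 W^\- Yn &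
        {ae P, forall w, Y w = Yp w - Yn w}].

End conditional_expectation.

Section chain.
Context {R : realType} {E : ptopologicalType}.

(* [P x] is the law on path space, started at x, of the time-homogeneous Markov
   chain with one-step transition kernel [Q]. *)
Definition markov_chain (P : E -> probability (Omega E) R) : Prop :=
  [/\ measurable_fun setT (P : borel E -> pprobability (Omega E) R),
      forall x, P x [set w | coord 0 w = x] = 1%E &
      exists Q : R.-pker (borel E) ~> (borel E),
        forall x t (B : set (borel E)), measurable B ->
          is_cexp (P x) (filtration E t) \1_(coord t.+1 @^-1` B)
                  (fun w => fine (Q (coord t w) B))].

End chain.

Section risk_mappings.
Context {R : realType} {E : ptopologicalType}.

Definition risk_mapping (P : probability (Omega E) R)
    (rho : (Omega E -> R) -> R) : Prop :=
  [/\ rho (cst 0) = 0,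
      forall Z c, bF R E Z -> rho (Z \+ cst c) = c + rho Z &
      forall Z Z', bF R E Z -> bF R E Z' ->
        {ae P, forall w, Z w <= Z' w} -> rho Z <= rho Z'].

Definition conditional_risk_mapping (P : probability (Omega E) R) (t : nat)
    (rho : (Omega E -> R) -> (Omega E -> R)) : Prop :=
  [/\ forall Z, bF R E Z -> bF_ R E t (rho Z),
      {ae P, forall w, rho (cst 0) w = 0},
      forall Z Z', bF R E Z -> bF_ R E t Z' ->
        {ae P, forall w, rho (Z \+ Z') w = Z' w + rho Z w} &
      forall Z Z', bF R E Z -> bF R E Z' ->
        {ae P, forall w, Z w <= Z' w} ->
        {ae P, forall w, rho Z w <= rho Z' w}].

(* A sequence (rho_t)_t whose time-0 member [rho0] is real-valued and whose
   members [rhot t], t >= 1, are random variables; [rhot 0] is irrelevant. *)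
Record dynmap := Dynmap {
  rho0 : (Omega E -> R) -> R;
  rhot : nat -> (Omega E -> R) -> (Omega E -> R) }.

Definition at_time (rho : dynmap) (t : nat) (Z : Omega E -> R) : Omega E -> R :=
  if t is 0 then cst (rho0 rho Z) else rhot rho t Z.

Definition dynamic_conditional_risk_mapping (P : probability (Omega E) R)
    (rho : dynmap) : Prop :=
  risk_mapping P (rho0 rho) /\
  forall t, (1 <= t)%N -> conditional_risk_mapping P t (rhot rho t).

Definition regular (rho : E -> (Omega E -> R) -> R) : Prop :=
  forall Z, bF R E Z ->
    bounded_fun (rho ^~ Z) /\
    measurable_fun setT (rho ^~ Z : borel E -> R).

Definition markovian (P : E -> probability (Omega E) R) (rho : E -> dynmap) :
    Prop :=
  regular (fun x => rho0 (rho x)) /\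
  forall x Z t, bF R E Z ->
    {ae P x, forall w,
       at_time (rho x) t (Z \o shift t) w = rho0 (rho (coord t w)) Z}.

End risk_mappings.

Section iterated_risk.
Context {R : realType} {E : ptopologicalType}.
Variable P : E -> probability (Omega E) R.
(* [g k] is used for k >= 1 only. *)
Variables (g0 : R * E -> R) (g : nat -> R * R * E -> R).

Fixpoint iterR (k : nat) (x : E) (Z : Omega E -> R) : R :=
  match k with
  | 0 => fine 'E_(P x)[fun w => g0 (Z w, coord 0 w)]
  | k'.+1 => fine 'E_(P x)[fun w =>
               g k (Z w, iterR k' (coord 0 w) Z, coord 0 w)]
  end.

(* [Y] is a version of R_k^x(Z | F_t). *)
Fixpoint is_iterR_cond (k : nat) (x : E) (t : nat) (Z Y : Omega E -> R) :
    Prop :=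
  match k with
  | 0 => is_cexp (P x) (filtration E t) (fun w => g0 (Z w, coord t w)) Y
  | k'.+1 => exists2 Y' : Omega E -> R, is_iterR_cond k' x t Z Y' &
      is_cexp (P x) (filtration E t)
        (fun w => g k (Z w, Y' w, coord t w)) Y
  end.

End iterated_risk.

(* Main.v *)
(* The g_k are only bounded on compact sets, so E^x[g_k(...) | F_t] need not
   concern an integrable variable.  Under P^y, however, X_0 = y almost surely,
   so for bounded Z the vector (Z, R_{k-1}^{X_0}(Z), X_0) stays in a compact set
   depending on y, and E^y[W^+], E^y[W^-] are finite for W = g_k(Z, ..., X_0).
   The simple Markov property for nonnegative W identifies E^{X_t}[W^+] and
   E^{X_t}[W^-] as versions of the conditional expectations of W^+ o theta_t and
   W^- o theta_t, and an almost sure uniqueness argument that needs no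
   integrability gives R_k^x(Z o theta_t | F_t) = R_k^{X_t}(Z) by induction on
   k.  The uniform bound required by regularity comes from monotonicity and
   translation invariance: |Z| <= M implies |rho^x(Z)| <= M. *)

Require Import Defs.
From HB Require Import structures.
From mathcomp Require Import all_boot all_order all_algebra.
From mathcomp Require Import all_classical all_reals all_analysis.
From mathcomp Require Import measurable_realfun giry.

Set Implicit Arguments.
Unset Strict Implicit.
Unset Printing Implicit Defensive.

Import Order.TTheory GRing.Theory Num.Theory.
Import numFieldNormedType.Exports.

Local Open Scope classical_set_scope.
Local Open Scope ring_scope.

(* MathComp's own [coord] and [shift] shadow those of [Defs]. *)
Local Notation coord := Defs.coord.
Local Notation shift := Defs.shift.

(** * Comparing integrals against two kernels over an event *)

Section restricted_kernels.
Context d d' (T : measurableType d) (Y : measurableType d') (R : realType).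
Variables (P : probability T R) (A : set T) (mA : measurable A).
Implicit Type k : T -> giry Y R.

Local Open Scope ereal_scope.

Let onA k (w : T) : giry Y R := if w \in A then k w else mzero.

Let onAE k f w : giry_int (onA k w) f = ((fun w => giry_int (k w) f) \_ A) w.
Proof.
rewrite /onA patchE; case: ifPn => // _.
exact: integral_measure_zero.
Qed.

Let measurable_onA k :
  (forall B, measurable B -> measurable_fun setT (k ^~ B)) ->
  measurable_fun setT (onA k).
Proof.
move=> mk; apply: measurable_giry_codensity => // B mB.
rewrite [X in measurable_fun _ X](_ : _ = (k ^~ B) \_ A).
  by apply/(measurable_restrictT _ mA).1/measurable_funTS/mk.
by apply/funext => w; rewrite /onA patchE; case: ifPn.
Qed.

(* Extending the kernels by the zero measure outside [A], both sides are
   integrals of [h] against finite measures (Giry binds) that agree on the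
   pi-system [G]. *)
Lemma integral_kernel_eq (G : set (set Y)) k1 k2 (h : Y -> \bar R) :
  (forall B, measurable B -> measurable_fun setT (k1 ^~ B)) ->
  (forall B, measurable B -> measurable_fun setT (k2 ^~ B)) ->
  measurable = <<s G >> -> setI_closed G -> G setT ->
  (forall B, G B -> \int[P]_(w in A) k1 w B = \int[P]_(w in A) k2 w B) ->
  measurable_fun setT h -> (forall y, 0 <= h y) ->
  \int[P]_(w in A) \int[k1 w]_y h y = \int[P]_(w in A) \int[k2 w]_y h y.
Proof.
move=> mk1 mk2 GE GI GT k12 mh h0.
pose m1 := giry_bind (P : giry T R) (measurable_onA mk1).
pose m2 := giry_bind (P : giry T R) (measurable_onA mk2).
have mE k (mk : forall B, measurable B ->
    measurable_fun setT (k ^~ B)) B : measurable B ->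
    giry_bind (P : giry T R) (measurable_onA mk) B = \int[P]_(w in A) k w B.
  move=> mB; rewrite -[B in LHS]setIT -[LHS]integral_indic//.
  rewrite [LHS]giry_int_bind//; last exact/measurable_EFinP/measurable_indic.
  rewrite /giry_int [RHS]integral_mkcond; apply: eq_integral => w _.
  rewrite [LHS]onAE !patchE; case: ifPn => // _.
  by rewrite /giry_int integral_indic// setIT.
have m12 B : measurable B -> m1 B = m2 B.
  have GM C : G C -> measurable C.
    by move=> GC; rewrite GE; exact: sub_gen_smallest.
  (* The constant sequence [setT] exhausts the space from within [G]; the measures are finite on it
     because Giry points have total mass at most 1. *)
  apply: (measure_unique G (fun=> setT)) => //.
  - by rewrite bigcup_const//; exists 0%N.
  - move=> C GC; have mC := GM _ GC.
    by apply: etrans (mE _ mk1 _ mC) _; rewrite k12//; exact/esym/mE.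
  - by move=> _; exact: le_lt_trans sprobability_setT (ltry 1).
have mI k (mk : forall B, measurable B ->
    measurable_fun setT (k ^~ B)) :
    giry_int (giry_bind (P : giry T R) (measurable_onA mk)) h =
    \int[P]_(w in A) \int[k w]_y h y.
  rewrite giry_int_bind// /giry_int [RHS]integral_mkcond.
  by apply: eq_integral => w _; exact: onAE.
rewrite -(mI _ mk1) -(mI _ mk2).
by apply: eq_measure_integral => B mB _; exact: m12.
Qed.

End restricted_kernels.

(** * Almost sure uniqueness of nonnegative conditional expectations *)

Lemma measurable_wrtP d (T : measurableType d) (R : realType) (Z : T -> R) :
  measurable_wrt measurable Z <-> measurable_fun setT Z.
Proof.
split=> [mZ _ B mB|mZ _ [B mB <-]]; last exact: mZ.
by apply: mZ; exists B.
Qed.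

(** Integrals of [Y1] and [Y2] may be infinite, so they cannot be subtracted globally. The set where
    one version exceeds the other is cut into events on which the smaller version is bounded; there
    the subtraction is legitimate and forces the difference to vanish almost surely. *)
Lemma cexp_ge0_unique d (T : measurableType d) (R : realType)
    (P : probability T R) (G : set (set T)) (W Y1 Y2 : T -> R) :
  <<s G >> `<=` measurable ->
  is_cexp_ge0 P <<s G >> W Y1 -> is_cexp_ge0 P <<s G >> W Y2 ->
  {ae P, forall w, Y1 w = Y2 w}.
Proof.
move=> GT cY1 cY2.
suff le_ae Y Y' : is_cexp_ge0 P <<s G >> W Y -> is_cexp_ge0 P <<s G >> W Y' ->
    {ae P, forall w, Y w <= Y' w}.
  apply: filterS2 (le_ae _ _ cY1 cY2) (le_ae _ _ cY2 cY1) => w le12 le21.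
  by apply/eqP; rewrite eq_le le12.
move=> [Y0 GY intY] [Y'0 GY' intY'].
(* [TG] is [T] with the coarser sigma-algebra, so that closure properties of measurable functions
   place the events [N n] in [<<s G>>], where the defining identities apply. *)
pose TG := g_sigma_algebraType G.
have mGY : measurable_fun setT (Y : TG -> R) by exact/measurable_wrtP.
have mGY' : measurable_fun setT (Y' : TG -> R) by exact/measurable_wrtP.
have sub_meas (f : T -> R) : measurable_fun setT (f : TG -> R) ->
    measurable_fun setT f.
  by move=> mf _ B mB; apply: GT; exact: mf.
have mY := sub_meas _ mGY; have mY' := sub_meas _ mGY'.
pose N n : set T := (Y \- Y') @^-1` `]0, +oo[ `&` Y' @^-1` `]-oo, n%:R].
have GN n : <<s G >> (N n).
  have mGD : measurable_fun setT ((Y \- Y') : TG -> R).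
    exact: measurable_funB.
  apply: (@measurableI _ TG).
    by rewrite -[X in measurable X]setTI; exact: mGD.
  by rewrite -[X in measurable X]setTI; exact: mGY'.
have mN n : measurable (N n) by exact: GT (GN n).
have PN n : P.-negligible (N n).
  have Nle w : N n w -> 0 <= Y w - Y' w.
    by move=> [+ _]; rewrite /= in_itv/= andbT => /ltW.
  (* The left side is the integral of [Y] over [N n], and both [Y] and [Y'] have the integral of [W]
     there. *)
  have intN : (\int[P]_(w in N n) (Y' w)%:E + \int[P]_(w in N n) (Y w - Y' w)%:E
      = \int[P]_(w in N n) (Y' w)%:E)%E.
    rewrite -ge0_integralD//.
    - rewrite -intY'; last exact: GN.
      rewrite intY; last exact: GN.
      by apply: eq_integral => w _; rewrite -EFinD addrC subrK.
    - by move=> w _; rewrite lee_fin.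
    - exact/measurable_EFinP/measurable_funTS.
    - exact/measurable_EFinP/measurable_funTS/measurable_funB.
  have finN : (\int[P]_(w in N n) (Y' w)%:E)%E \is a fin_num.
    rewrite ge0_fin_numE; last by apply: integral_ge0 => w _; rewrite lee_fin.
    apply: (@le_lt_trans _ _ (\int[P]_(w in N n) (cst n%:R%:E) w)%E).
      apply: ge0_le_integral => //.
      - by move=> w _; rewrite lee_fin.
      - exact/measurable_EFinP/measurable_funTS.
      - by move=> w [_]; rewrite /= in_itv/= lee_fin.
    rewrite integral_cst//= (@le_lt_trans _ _ n%:R%:E) ?ltry//.
    by rewrite -[leRHS]mule1 lee_wpmul2l ?lee_fin ?probability_le1.
  have int0 : (\int[P]_(w in N n) `|(Y w - Y' w)%:E|)%E = 0%E.
    transitivity (\int[P]_(w in N n) (Y w - Y' w)%:E)%E.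
      by apply: eq_integral => w /set_mem Nw; rewrite gee0_abs// lee_fin Nle.
    by rewrite -[LHS](addeK _ finN) [X in (X - _)%E]addeC intN subee.
  (* The difference is null almost everywhere on [N n] but strictly positive at each of its points,
     so [N n] itself is negligible. *)
  have [M [mM M0 NM]] : ae_eq P (N n) (fun w => (Y w - Y' w)%:E) (cst 0%E).
    apply/ae_eq_integral_abs => //.
    exact/measurable_EFinP/measurable_funTS/measurable_funB.
  exists M; split=> // w Nw; apply: NM => /= /(_ Nw) [Yw].
  by move: Nw => [+ _]; rewrite /= in_itv/= Yw ltxx.
apply: negligibleS (negligible_bigcup PN) => w /= /negP; rewrite -ltNge => YY'.
exists (Num.bound (Y' w)) => //; split; rewrite /= in_itv/=.
  by rewrite subr_gt0 YY'.
exact/ltW/archi_boundP.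
Qed.

(** * Measurability of coordinates and shifts on path space *)

Section filtration.
Variable E : ptopologicalType.

(** The generator of [filtration E t], named so that [past t] below is a measurable type carrying
    F_t and measurability with respect to F_t becomes ordinary measurability. *)
Definition past_events (t : nat) : set (set (nat -> E)) :=
  \bigcup_(s in [set s | (s <= t)%N])
    preimage_set_system setT (coord s) (@measurable _ (borel E)).

Definition past (t : nat) : measurableType _ :=
  g_sigma_algebraType (past_events t).

Lemma filtration_Omega t : filtration E t `<=` @measurable _ (Omega E).
Proof. by move=> A FA; apply: sub_sigma_algebra; exists t. Qed.

Lemma filtrationS t : filtration E t `<=` filtration E t.+1.
Proof.
by apply: sub_sigma_algebra2; apply: bigcup_subset => s /= /leqW.
Qed.

Lemma measurable_coord_past t :
  measurable_fun setT (coord t : past t -> borel E).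
Proof.
by move=> _ B mB; apply: sub_sigma_algebra; exists t => /=; [|exists B].
Qed.

Lemma measurable_coord t : measurable_fun setT (coord t : Omega E -> borel E).
Proof.
move=> _ B mB; apply: filtration_Omega; exact: measurable_coord_past.
Qed.

Lemma measurable_to_Omega d (T : measurableType d) (f : T -> Omega E) :
  (forall s, measurable_fun setT (coord s \o f : T -> borel E)) ->
  measurable_fun setT f.
Proof.
move=> mf.
(* The sigma-algebra of [Omega] is generated in two stages, so preimages are checked first on the
   generators of each F_t and then on the union. *)
have mft t : measurable_fun setT (f : T -> past t).
  apply: (@measurability _ _ T (past t) setT f (past_events t))
    => // _ [_ [s _ [B mB <-]] <-].
  by rewrite !setTI; have := mf s measurableT B mB; rewrite setTI.
apply: (@measurability _ _ T (Omega E) setT f (\bigcup_t filtration E t))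
  => // _ [A [t _ FA] <-].
exact: (mft t measurableT A FA).
Qed.

Lemma measurable_shift t :
  measurable_fun setT (@shift E t : Omega E -> Omega E).
Proof. by apply: measurable_to_Omega => s; exact: measurable_coord. Qed.

End filtration.

(** * Cylinders as a generating pi-system *)

Section cylinders.
Variable E : ptopologicalType.

Definition cylinder n (B : nat -> set E) : set (nat -> E) :=
  [set w | forall i, (i < n)%N -> B i (w i)].

Definition cylinders : set (set (nat -> E)) :=
  [set C | exists n (B : nat -> set (borel E)),
    (forall i, measurable (B i)) /\ C = cylinder n B].

Lemma measurable_cylinder n (B : nat -> set (borel E)) :
  (forall i, measurable (B i)) -> @measurable _ (Omega E) (cylinder n B).
Proof.
move=> mB; have -> : cylinder n B =
    \bigcap_(i in [set i | (i < n)%N]) (coord i @^-1` B i) by [].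
apply: (@bigcap_measurableType _ (Omega E)) => i _.
by rewrite -[X in measurable X]setTI; exact: measurable_coord.
Qed.

Lemma cylinders_setI : setI_closed cylinders.
Proof.
have mimp (b : bool) (D : set (borel E)) : measurable D ->
    measurable [set x | b -> D x].
  case: b => mD.
    by rewrite (_ : [set _ | _] = D)//; apply/seteqP; split => x //=; exact.
  by rewrite (_ : [set _ | _] = setT)//; apply/seteqP; split.
move=> _ _ [n [B [mB ->]]] [m [C [mC ->]]].
(* The larger length is taken, and each family of constraints is made vacuous beyond its own
   length. *)
exists (maxn n m), (fun i => [set x | ((i < n)%N -> B i x)] `&`
                              [set x | ((i < m)%N -> C i x)]); split.
  by move=> i; apply: measurableI; exact: mimp.
apply/seteqP; split=> [w [Bw Cw] i _|w BCw].
  by split => /=; [exact: Bw|exact: Cw].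
by split=> i ilt; have [|Bi Ci] := BCw i; rewrite ?leq_max ?ilt ?orbT//;
  [exact: Bi|exact: Ci].
Qed.

Lemma cylindersT : cylinders setT.
Proof.
exists 0%N, (fun=> setT); split=> //.
by apply/seteqP; split.
Qed.

Lemma measurable_Omega_cylinders :
  @measurable _ (Omega E) = <<s cylinders >>.
Proof.
apply/seteqP; split; last first.
  apply: smallest_sub; first exact: sigma_algebra_measurable.
  by move=> _ [n [B [mB ->]]]; exact: measurable_cylinder.
apply: smallest_sub; first exact: smallest_sigma_algebra.
move=> A [t _]; apply: smallest_sub; first exact: smallest_sigma_algebra.
move=> _ [s _ [B mB <-]]; apply: sub_sigma_algebra.
(* The event that X_s lies in [B] needs length [s.+1] for index [s] to be constrained; the earlier
   coordinates are left free. *)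
exists s.+1, (fun i => if i == s then B else setT); split.
  by move=> i; case: ifP.
rewrite setTI; apply/seteqP; split=> [w Bw i|w /(_ s)].
  by case: eqP => // ->.
by rewrite eqxx; exact.
Qed.

End cylinders.

(** * From the one-step kernel to the simple Markov property *)

Section kernel_giry.
Context d d' (X : measurableType d) (Y : measurableType d') (R : realType).
Variable k : R.-pker X ~> Y.

Let kernel_at x : set Y -> \bar R := k x.

HB.instance Definition _ x := Measure.on (kernel_at x).

Let kernel_at_le1 x : (kernel_at x setT <= 1)%E.
Proof. by rewrite /kernel_at prob_kernel. Qed.

HB.instance Definition _ x :=
  Measure_isSubProbability.Build _ _ _ (kernel_at x) (kernel_at_le1 x).

(** Presents the fibres of a probability kernel as points of the Giry space, the form in which
    [integral_kernel_eq] compares kernels. *)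
Definition kernel_giry x : giry Y R := kernel_at x.

End kernel_giry.

Section simple_markov_property.
Context {R : realType} {E : ptopologicalType}.
Variable P : E -> probability (Omega E) R.
Hypothesis mP : measurable_fun setT (P : borel E -> pprobability (Omega E) R).
Hypothesis P_start : forall x, {ae P x, forall w : Omega E, coord 0 w = x}.
Variable Q : R.-pker (borel E) ~> (borel E).
Hypothesis PQ : forall x t (B : set (borel E)), measurable B ->
  is_cexp (P x) (filtration E t) \1_(coord t.+1 @^-1` B)
          (fun w => fine (Q (coord t w) B)).

Local Open Scope ereal_scope.

Lemma measurable_law (C : set (Omega E)) : measurable C ->
  measurable_fun setT ((fun x => P x C) : borel E -> \bar R).
Proof. exact: (measurable_kernel (kprobability mP)). Qed.

Lemma measurable_integral_law (f : Omega E -> \bar R) :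
  measurable_fun setT f -> (forall w, 0 <= f w) ->
  measurable_fun setT ((fun x => \int[P x]_w f w) : borel E -> \bar R).
Proof.
move=> mf f0.
apply: (measurable_fun_integral_kernel (l := P : borel E -> _)) => //.
exact: measurable_law.
Qed.

(** [is_cexp] speaks of positive and negative parts separately. An indicator has zero negative part,
    so uniqueness makes [Yn] vanish almost surely and [Yp] agrees with the kernel. *)
Lemma one_step_event x t A (B : set (borel E)) :
  filtration E t A -> measurable B ->
  \int[P x]_(w in A) (\1_B (coord t.+1 w))%:E =
  \int[P x]_(w in A) Q (coord t w) B.
Proof.
move=> FA mB; have mA := filtration_Omega FA.
have mQ : measurable_fun setT
    ((fun w => Q (coord t w) B) : Omega E -> \bar R).
  by apply: measurableT_comp (measurable_kernel Q B mB) (@measurable_coord E t).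
have Qfin w : Q (coord t w) B \is a fin_num.
  rewrite ge0_fin_numE// (le_lt_trans _ (ltry 1))//.
  by rewrite -(prob_kernel (s := Q) (coord t w)) le_measure ?inE.
have [_ [Yp [Yn [cYp cYn QY]]]] := PQ x t mB.
have Yn0 : {ae P x, forall w, Yn w = 0%R}.
  apply: (@cexp_ge0_unique _ (Omega E) _ _ (@past_events E t) _ _ _
    (@filtration_Omega E t) cYn).
  split=> //.
    by apply/(@measurable_wrtP _ (past E t)).
  move=> D FD; apply: eq_integral => w _; congr EFin.
  by rewrite (@ge0_funrnegE _ _ setT) ?inE.
have [_ mYp intYp] := cYp.
transitivity (\int[P x]_(w in A) (Yp w)%:E).
  rewrite -intYp//; apply: eq_integral => w _; congr EFin.
  by rewrite (@ge0_funrposE _ _ setT) ?inE.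
apply: ge0_ae_eq_integral => //.
- apply/measurable_EFinP/measurable_funTS/measurable_wrtP.
  exact: subset_trans mYp (@filtration_Omega E t).
- exact: measurable_funTS.
- by move=> w _; rewrite lee_fin; case: cYp.
- apply: filterS2 QY Yn0 => w QYw Ynw _.
  by rewrite -[RHS]fineK// QYw Ynw subr0.
Qed.

(** Evaluation at X_(t+1) is integration against a Dirac kernel. This kernel and [Q] at X_t have
    equal integrals over [A] on all Borel sets, hence on all nonnegative measurable [h]. *)
Lemma one_step x t A (h : borel E -> \bar R) :
  filtration E t A -> measurable_fun setT h -> (forall y, 0 <= h y) ->
  \int[P x]_(w in A) h (coord t.+1 w) =
  \int[P x]_(w in A) \int[Q (coord t w)]_y h y.
Proof.
move=> FA mh h0; have mA := filtration_Omega FA.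
transitivity (\int[P x]_(w in A) \int[giry_ret (coord t.+1 w : borel E)]_y h y).
  by apply: eq_integral => w _; rewrite [RHS]giry_int_ret.
transitivity (\int[P x]_(w in A) \int[kernel_giry Q (coord t w)]_y h y);
    last first.
  by apply: eq_integral => w _; exact: eq_measure_integral.
apply: (@integral_kernel_eq _ _ (Omega E) (borel E) R (P x) A mA measurable
  (fun w => giry_ret (coord t.+1 w : borel E))
  (fun w => kernel_giry Q (coord t w))) => //.
- move=> B mB; rewrite /giry_ret.
  apply: (@measurableT_comp _ _ _ _ _ _ (fun y : borel E => \d_y B)).
    exact: measurable_fun_dirac.
  exact: measurable_coord.
- move=> B mB.
  exact: measurableT_comp (measurable_kernel Q B mB) (@measurable_coord E t).
- by rewrite smallest_id//; exact: sigma_algebra_measurable.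
- exact: measurableI.
- move=> B mB; apply: etrans (one_step_event x FA mB).
  by apply: eq_integral => w _; exact: diracE.
Qed.

(* Taking [t = 0] and [A = setT] shows that necessarily [u y] is the
   [P y]-probability of the cylinder; leaving [u] abstract lets the induction
   produce it through [Q]. *)
Lemma cylinder_density n (B : nat -> set (borel E)) :
  (forall i, measurable (B i)) -> exists u : borel E -> \bar R,
  [/\ measurable_fun setT u, forall y, 0 <= u y &
      forall x t A, filtration E t A ->
      P x (A `&` shift t @^-1` cylinder n B) =
      \int[P x]_(w in A) u (coord t w)].
Proof.
elim: n B => [|n IH] B mB.
  exists (cst 1); split=> // x t A FA.
  rewrite integral_cst ?mul1e; last exact: (filtration_Omega FA).
  by congr (P x _); apply/seteqP; split=> [w []//|w Aw]; split.
have [u [mu u0 uE]] := IH (B \o S) (fun i => mB i.+1).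
pose Qu (y : borel E) : \bar R := \int[Q y]_z u z.
have mQu : measurable_fun setT Qu.
  apply: (measurable_fun_integral_kernel (l := Q)) => //.
  exact: measurable_kernel.
have Qu0 y : 0 <= Qu y by apply: integral_ge0.
(* The first constraint concerns X_t and restricts the density; the remaining ones start at time
   t+1, and [Q] averages their density back to time t. *)
exists (Qu \_ (B 0%N)); split.
- have /iffLR := @measurable_restrictT _ _ (borel E) _ (B 0%N) Qu (mB 0%N).
  by apply; exact: measurable_funTS.
- by move=> y; rewrite /patch; case: ifP.
move=> x t A FA.
have FA' : filtration E t (A `&` coord t @^-1` B 0%N).
  apply: (@measurableI _ (past E t)) => //.
  rewrite -[X in measurable X]setTI.
  exact: (measurable_coord_past measurableT (mB 0%N)).
transitivity (P x ((A `&` coord t @^-1` B 0%N) `&`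
    shift t.+1 @^-1` cylinder n (B \o S))).
  congr (P x _); rewrite -setIA; congr (_ `&` _).
  apply/seteqP; split=> [w Bw|w [B0 BS] [|i] ilt].
  - split; first by have := Bw 0%N isT; rewrite /shift addn0.
    by move=> i ilt; have := Bw i.+1 ilt; rewrite /shift addnS addSn.
  - by rewrite /shift addn0.
  - by have := BS i ilt; rewrite /shift addnS addSn.
rewrite uE; last exact: filtrationS.
rewrite one_step// integral_mkcondr; apply: eq_integral => w _.
by rewrite !patchE; congr (if _ then _ else _); apply/idP/idP; rewrite !inE.
Qed.

(** The Dirac kernel at the shifted path is compared with the law started at X_t. On cylinders both
    sides reduce to the integral of the density [u] of [cylinder_density], and cylinders form a
    generating pi-system. *)
Lemma markov_property x t A (W : Omega E -> \bar R) :
  filtration E t A -> measurable_fun setT W -> (forall w, 0 <= W w) ->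
  \int[P x]_(w in A) W (shift t w) =
  \int[P x]_(w in A) \int[P (coord t w)]_v W v.
Proof.
move=> FA mW W0; have mA := filtration_Omega FA.
transitivity (\int[P x]_(w in A) \int[giry_ret (shift t w : Omega E)]_v W v).
  by apply: eq_integral => w _; rewrite [RHS]giry_int_ret.
apply: (@integral_kernel_eq _ _ (Omega E) (Omega E) R (P x) A mA (@cylinders E)
  (fun w => giry_ret (shift t w : Omega E)) (fun w => P (coord t w))) => //.
- move=> B mB; rewrite /giry_ret.
  apply: (@measurableT_comp _ _ _ _ _ _ (fun y : Omega E => \d_y B)).
    exact: measurable_fun_dirac.
  exact: measurable_shift.
- move=> B mB.
  exact: measurableT_comp (measurable_law mB) (@measurable_coord E t).
- exact: measurable_Omega_cylinders.
- exact: cylinders_setI.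
- exact: cylindersT.
move=> _ [n [B [mB ->]]]; have mC := measurable_cylinder n mB.
have [u [mu u0 uE]] := cylinder_density n mB.
have PE y : P y (cylinder n B) = u y.
  have := uE y 0%N setT (@measurableT _ (past E 0)).
  rewrite setTI => ->.
  transitivity (\int[P y]_w (cst (u y) : Omega E -> \bar R) w); last first.
    by rewrite integral_cst// [X in _ * X](probability_setT (P y)) mule1.
  apply: ge0_ae_eq_integral => //.
  - exact: measurableT_comp mu (@measurable_coord E 0%N).
  - by move=> w _; exact: u0.
  - by apply: filterS (P_start y) => w -> _.
transitivity (P x (A `&` shift t @^-1` cylinder n B)).
  rewrite setIC -integral_indic//.
  rewrite -[X in measurable X]setTI.
  exact: (@measurable_shift E t measurableT _ mC).
by rewrite uE//; apply: eq_integral => w _; exact/esym/PE.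
Qed.

End simple_markov_property.

(** * Conditional expectations of shifted variables *)

Section cexp_shift.
Context {R : realType} {E : ptopologicalType}.
Variable P : E -> probability (Omega E) R.
Hypothesis mP : measurable_fun setT (P : borel E -> pprobability (Omega E) R).
Hypothesis P_start : forall x, {ae P x, forall w : Omega E, coord 0 w = x}.
Variable Q : R.-pker (borel E) ~> (borel E).
Hypothesis PQ : forall x t (B : set (borel E)), measurable B ->
  is_cexp (P x) (filtration E t) \1_(coord t.+1 @^-1` B)
          (fun w => fine (Q (coord t w) B)).

Lemma ae_bounded_integral_fin_num (y : E) (f : Omega E -> R) (M : R) :
  measurable_fun setT f -> (forall w, 0 <= f w) ->
  {ae P y, forall w, f w <= M} ->
  (\int[P y]_w (f w)%:E)%E \is a fin_num.
Proof.
move=> mf f0 fM.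
(* [M] may be negative, so its absolute value is used to keep the dominating constant
   nonnegative. *)
have M0w : {ae P y, forall w, (f w)%:E <= `|M|%:E}%E.
  by apply: filterS fM => w fw; rewrite lee_fin (le_trans fw)// ler_norm.
rewrite ge0_fin_numE; last by apply: integral_ge0 => w _; rewrite lee_fin.
apply: (@le_lt_trans _ _ (\int[P y]_w cst `|M|%:E w)%E).
  apply: ae_ge0_le_integral => //.
  - by move=> w _; rewrite lee_fin.
  - exact/measurable_EFinP.
  - by move=> w _; rewrite lee_fin.
  - by apply: filterS M0w => w + _.
by rewrite integral_cst// [X in (_ * X)%E](probability_setT (P y)) mule1 ltry.
Qed.

(** Integrability is not assumed: both parts are measurable extended-real functions of the starting
    point, so is their difference, and [fine] is measurable, sending infinite values to 0. *)
Lemma measurable_expectation_law (W : Omega E -> R) :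
  measurable_fun setT W ->
  measurable_fun setT ((fun y => fine 'E_(P y)[W]) : borel E -> R).
Proof.
move=> mW; apply: (measurableT_comp (fine_measurable measurableT)).
rewrite (_ : (fun y => 'E_(P y)[W])%E =
    (fun y => \int[P y]_w (W^\+ w)%:E - \int[P y]_w (W^\- w)%:E)%E); last first.
  by apply/funext => y; rewrite unlock integralE funerpos funerneg.
apply: emeasurable_funB; apply: (measurable_integral_law mP).
- exact/measurable_EFinP/measurable_funrpos.
- by move=> w; rewrite lee_fin funrpos_ge0.
- exact/measurable_EFinP/measurable_funrneg.
- by move=> w; rewrite lee_fin funrneg_ge0.
Qed.

(** The Markov property supplies the integral identity; finiteness under every [P y] ensures that
    [fine] loses nothing. *)
Lemma is_cexp_ge0_shift x t (f : Omega E -> R) :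
  measurable_fun setT f -> (forall w, 0 <= f w) ->
  (forall y, (\int[P y]_v (f v)%:E)%E \is a fin_num) ->
  is_cexp_ge0 (P x) (filtration E t) (f \o shift t)
    (fun w => fine (\int[P (coord t w)]_v (f v)%:E)%E).
Proof.
move=> mf f0 finf; split.
- by move=> w; apply/fine_ge0/integral_ge0 => v _; rewrite lee_fin.
- apply/(@measurable_wrtP _ (past E t)).
  apply: (measurableT_comp (fine_measurable measurableT)).
  apply: (@measurableT_comp _ _ _ (past E t) (borel E) _
    (fun y => \int[P y]_v (f v)%:E)%E); last exact: measurable_coord_past.
  apply: (measurable_integral_law mP); first exact/measurable_EFinP.
  by move=> w; rewrite lee_fin.
- move=> A FA.
  transitivity (\int[P x]_(w in A) \int[P (coord t w)]_v (f v)%:E)%E.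
    apply: (markov_property mP P_start PQ x FA (W := EFin \o f)).
      exact/measurable_EFinP.
    by move=> w; rewrite lee_fin.
  by apply: eq_integral => w _; rewrite fineK.
Qed.

(** The bound may depend on [y], so W composed with the shift need not be integrable under [P x].
    Uniqueness is therefore applied to the positive and negative parts separately, and the
    difference is taken pointwise between finite values. *)
Lemma is_cexp_shift x t (W Y : Omega E -> R) :
  measurable_fun setT W ->
  (forall y, exists M, {ae P y, forall w, `|W w| <= M}) ->
  is_cexp (P x) (filtration E t) (W \o shift t) Y ->
  {ae P x, forall w, Y w = fine 'E_(P (coord t w))[W]}.
Proof.
move=> mW bW [_ [Yp [Yn [cYp cYn YE]]]].
have finp y : (\int[P y]_v (W^\+ v)%:E)%E \is a fin_num.
  have [M WM] := bW y.
  apply: (@ae_bounded_integral_fin_num _ _ M); first exact: measurable_funrpos.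
    by move=> w; exact: funrpos_ge0.
  apply: filterS WM => w; apply: le_trans.
  by rewrite /funrpos ge_max ler_norm normr_ge0.
have finn y : (\int[P y]_v (W^\- v)%:E)%E \is a fin_num.
  have [M WM] := bW y.
  apply: (@ae_bounded_integral_fin_num _ _ M); first exact: measurable_funrneg.
    by move=> w; exact: funrneg_ge0.
  apply: filterS WM => w; apply: le_trans.
  by rewrite /funrneg ge_max -normrN ler_norm normr_ge0.
have Ypp := @cexp_ge0_unique _ (Omega E) _ _ (@past_events E t) _ _ _
  (@filtration_Omega E t) cYp
  (is_cexp_ge0_shift x t (measurable_funrpos mW) (@funrpos_ge0 _ _ W) finp).
have Ynn := @cexp_ge0_unique _ (Omega E) _ _ (@past_events E t) _ _ _
  (@filtration_Omega E t) cYn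
  (is_cexp_ge0_shift x t (measurable_funrneg mW) (@funrneg_ge0 _ _ W) finn).
apply: filterS3 YE Ypp Ynn => w -> -> ->.
by rewrite -fineB ?finp ?finn// unlock [in RHS]integralE funerpos funerneg.
Qed.

End cexp_shift.

(** The same [Yp] and [Yn] serve for both variables. This allows the inner conditional value in the
    recursion for R_k to be replaced by an almost surely equal one. *)
Lemma eq_ae_is_cexp d (T : measurableType d) (R : realType)
    (P : probability T R) (G : set (set T)) (W W' Y : T -> R) :
  G `<=` measurable ->
  measurable_fun setT W -> measurable_fun setT W' ->
  {ae P, forall w, W w = W' w} -> is_cexp P G W Y -> is_cexp P G W' Y.
Proof.
move=> GT mW mW' WW' [GY [Yp [Yn [[p0 Gp intp] [n0 Gn intn] YE]]]].
split=> //; exists Yp, Yn; split=> //; split=> // A GA.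
- rewrite -intp//; apply: ge0_ae_eq_integral; first exact: GT.
  + exact/measurable_EFinP/measurable_funTS/measurable_funrpos.
  + exact/measurable_EFinP/measurable_funTS/measurable_funrpos.
  + by move=> w _; rewrite lee_fin funrpos_ge0.
  + by move=> w _; rewrite lee_fin funrpos_ge0.
  + by apply: filterS WW' => w ww' _; rewrite /funrpos ww'.
- rewrite -intn//; apply: ge0_ae_eq_integral; first exact: GT.
  + exact/measurable_EFinP/measurable_funTS/measurable_funrneg.
  + exact/measurable_EFinP/measurable_funTS/measurable_funrneg.
  + by move=> w _; rewrite lee_fin funrneg_ge0.
  + by move=> w _; rewrite lee_fin funrneg_ge0.
  + by apply: filterS WW' => w ww' _; rewrite /funrneg ww'.
Qed.

(** * The starting point as an almost sure value *)

Lemma polish_measurable_set1 (R : realType) (E : ptopologicalType) (x : E) :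
  polish R E -> measurable ([set x] : set (borel E)).
Proof.
move=> [_ [M [f [g [hM fK _ cf _]]]]].
have clx : closed [set x].
  have -> : [set x] = f @^-1` [set f x].
    by apply/seteqP; split=> [y ->//|y /= fyx]; rewrite -(fK y) fyx fK.
  apply: closed_comp; first by move=> y _; exact: cf.
  exact: compact_closed hM (@compact_set1 _ _).
rewrite -[X in measurable X]setCK; apply: measurableC.
by apply: sub_sigma_algebra; exact: closed_openC.
Qed.

(** Passing from mass 1 to an almost sure statement takes the complement, which requires the event
    to be measurable; hence the hypothesis on the singleton. *)
Lemma ae_coord0 (R : realType) (E : ptopologicalType)
    (P : probability (Omega E) R) (x : E) :
  measurable ([set x] : set (borel E)) ->
  P [set w | coord 0 w = x] = 1%E ->
  {ae P, forall w : Omega E, coord 0 w = x}.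
Proof.
move=> mx Px.
have mX : @measurable _ (Omega E) [set w | coord 0 w = x].
  have := @measurable_coord E 0 measurableT _ mx.
  by rewrite setTI.
exists (~` [set w | coord 0 w = x]); split=> //; first exact: measurableC.
by rewrite probability_setC// Px subee.
Qed.

(** * The iterated functionals and their Markov property *)

Section iterated_risk.
Context {R : realType} {E : ptopologicalType}.
Variable P : E -> probability (Omega E) R.
Hypothesis mP : measurable_fun setT (P : borel E -> pprobability (Omega E) R).
Hypothesis P_start : forall x, {ae P x, forall w : Omega E, coord 0 w = x}.
Variable Q : R.-pker (borel E) ~> (borel E).
Hypothesis PQ : forall x t (B : set (borel E)), measurable B ->
  is_cexp (P x) (filtration E t) \1_(coord t.+1 @^-1` B)
          (fun w => fine (Q (coord t w) B)).
Variables (K : nat) (g0 : R * E -> R) (g : nat -> R * R * E -> R).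
Hypothesis g0_meas : measurable_fun setT (g0 : R * borel E -> R).
Hypothesis g0_compact :
  forall C : set (R * E), compact C -> [bounded g0 p | p in C].
Hypothesis g_meas : forall k, (1 <= k <= K)%N ->
  measurable_fun setT (g k : R * R * borel E -> R).
Hypothesis g_compact : forall k, (1 <= k <= K)%N ->
  forall C : set (R * R * E), compact C -> [bounded g k p | p in C].

(** The inner functional is evaluated at X_0 rather than at a fixed start, so one path functional,
    independent of x, has R_k^x as its expectation under every [P x] and can be shifted. *)
Definition risk_integrand k (Z : Omega E -> R) (w : Omega E) : R :=
  if k is k'.+1 then g k (Z w, iterR P g0 g k' (coord 0 w) Z, coord 0 w)
  else g0 (Z w, coord 0 w).

Lemma iterRE k x Z : iterR P g0 g k x Z = fine 'E_(P x)[risk_integrand k Z].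
Proof. by case: k. Qed.

Lemma measurable_risk_integrand k (Z : Omega E -> R) : (k <= K)%N ->
  measurable_fun setT Z -> measurable_fun setT (risk_integrand k Z).
Proof.
move=> kK mZ; have m0 := @measurable_coord E 0.
elim: k kK => [_|k IH kK].
  exact: (measurableT_comp g0_meas (measurable_fun_pair mZ m0)).
have mR : measurable_fun setT ((fun x => iterR P g0 g k x Z) : borel E -> R).
  under eq_fun do rewrite iterRE.
  by apply: (measurable_expectation_law mP); apply: IH; exact: ltnW.
apply: (measurableT_comp (g_meas (k := k.+1) _)); first by rewrite kK.
exact: measurable_fun_pair (measurable_fun_pair mZ (measurableT_comp mR m0)) m0.
Qed.

Lemma measurable_iterR k Z : (k <= K)%N -> measurable_fun setT Z ->
  measurable_fun setT ((fun x => iterR P g0 g k x Z) : borel E -> R).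
Proof.
move=> kK mZ; under eq_fun do rewrite iterRE.
by apply: (measurable_expectation_law mP); exact: measurable_risk_integrand.
Qed.

Lemma ae_bounded_risk_integrand k (Z : Omega E -> R) (y : E) : (k <= K)%N ->
  bounded_fun Z ->
  exists M, {ae P y, forall w, `|risk_integrand k Z w| <= M}.
Proof.
move=> kK /pinfty_ex_gt0[N N0 ZN].
have ZI w : `[- N, N]%classic (Z w).
  by rewrite /= in_itv/= -ler_norml; exact: ZN.
case: k kK => [_|k kK].
  have /g0_compact/pinfty_ex_gt0[M _ gM] : compact (`[- N, N] `*` [set y]).
    by apply: compact_setX; [exact: segment_compact|exact: compact_set1].
  exists M; apply: filterS (P_start y) => w wy.
  by apply: (gM (Z w, coord 0 w)); split; [exact: ZI|exact: wy].
(* Under [P y] the inner functional is almost surely this constant, which depends on [y]. *)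
pose c := iterR P g0 g k y Z.
have cC : compact (`[- N, N] `*` [set c] `*` [set y]).
  apply: compact_setX (@compact_set1 _ _).
  by apply: compact_setX (@compact_set1 _ _); exact: segment_compact.
have /pinfty_ex_gt0[M _ gM] := g_compact (k := k.+1) kK cC.
exists M; apply: filterS (P_start y) => w wy; rewrite /risk_integrand wy.
by apply: (gM (Z w, c, y)); split=> //; split=> //; exact: ZI.
Qed.

(** By induction the inner version [Y'] equals R_(k-1)^(X_t) almost surely. Since X_t is X_0 after
    the shift, the conditioned variable is then almost surely the shifted [risk_integrand], to which
    [is_cexp_shift] applies. *)
Lemma iterR_markov k x t Z Y : (k <= K)%N ->
  bF R E Z -> is_iterR_cond P g0 g k x t (Z \o shift t) Y ->
  {ae P x, forall w, Y w = iterR P g0 g k (coord t w) Z}.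
Proof.
move=> kK [/measurable_wrtP mZ bZ].
have mW k' : (k' <= K)%N -> measurable_fun setT (risk_integrand k' Z).
  by move=> k'K; exact: measurable_risk_integrand.
have to_expectation k' Y' : (k' <= K)%N ->
    is_cexp (P x) (filtration E t) (risk_integrand k' Z \o shift t) Y' ->
    {ae P x, forall w, Y' w = iterR P g0 g k' (coord t w) Z}.
  move=> k'K cY; under eq_near do rewrite iterRE.
  apply: (is_cexp_shift mP P_start PQ (mW _ k'K)) cY => y.
  exact: ae_bounded_risk_integrand.
have coordE w : coord t w = coord 0 (shift t w).
  by rewrite /Defs.coord /Defs.shift addn0.
elim: k kK Y => [|k IH] kK Y.
  move=> cY; apply: to_expectation => //.
  rewrite (_ : _ \o _ = fun w => g0 ((Z \o shift t) w, coord t w))//.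
  by apply/funext => w /=; rewrite coordE.
move=> [Y' cY' cY]; have Y'E := IH (ltnW kK) _ cY'.
have mY' : measurable_fun setT Y'.
  apply/measurable_wrtP; apply: subset_trans (@filtration_Omega E t).
  (* For either form of the recursion, [Y'] satisfies some [is_cexp], whose first component is
     F_t-measurability. *)
  by case: k {IH kK cY Y'E} cY' => [[]//|k [? _ []]].
have mc := @measurable_coord E t; have ms := @measurable_shift E t.
apply: to_expectation => //.
apply: (@eq_ae_is_cexp _ (Omega E) _ _ _ _ _ _ (@filtration_Omega E t)) cY.
- apply: (measurableT_comp (g_meas (k := k.+1) _)); first by rewrite kK.
  have mZY := measurable_fun_pair (measurableT_comp mZ ms) mY'.
  exact: measurable_fun_pair mZY mc.
- exact: measurableT_comp (mW _ kK) ms.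
- by apply: filterS Y'E => w -> /=; rewrite coordE.
Qed.

End iterated_risk.

(** * Regularity and conclusion *)

Lemma risk_mapping_bounded (R : realType) (E : ptopologicalType)
    (P : probability (Omega E) R) (rho : (Omega E -> R) -> R) Z M :
  risk_mapping P rho -> bF R E Z -> (forall w, `|Z w| <= M) -> `|rho Z| <= M.
Proof.
move=> [rho_0 rho_cst rho_le] bZ ZM.
have bcst c : bF R E (cst c).
  split; first exact/measurable_wrtP.
  exists `|c|; split; first exact: num_real.
  by move=> N cN w _; exact: ltW.
have rho_c c : rho (cst c) = c.
  have -> : cst c = cst 0 \+ cst c :> (Omega E -> R).
    by apply/funext => w; rewrite /= add0r.
  by rewrite rho_cst// rho_0 addr0.
rewrite ler_norml -{1}(rho_c (- M)) -{2}(rho_c M).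
apply/andP; split; apply: rho_le => //; apply: aeW => w /=.
  by have := ZM w; rewrite ler_norml => /andP[].
by have := ZM w; rewrite ler_norml => /andP[].
Qed.

Theorem lemma3p1 (R : realType) (E : ptopologicalType) (polishE : polish R E)
    (P : E -> probability (Omega E) R) (chainP : markov_chain P)
    (K : nat) (g0 : R * E -> R) (g : nat -> R * R * E -> R)
    (g0_meas : measurable_fun setT (g0 : R * borel E -> R))
    (g0_compact : forall C : set (R * E), compact C -> [bounded g0 p | p in C])
    (g0_bounded : forall r : R, bounded_fun (fun x : E => g0 (r, x)))
    (g_meas : forall k, (1 <= k <= K)%N ->
       measurable_fun setT (g k : R * R * borel E -> R))
    (g_compact : forall k, (1 <= k <= K)%N ->
       forall C : set (R * R * E), compact C -> [bounded g k p | p in C])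
    (g_bounded : forall k, (1 <= k <= K)%N ->
       forall r : R * R, bounded_fun (fun x : E => g k (r, x)))
    (rho : E -> dynmap)
    (rho0E : forall x Z, bF R E Z -> rho0 (rho x) Z = iterR P g0 g K x Z)
    (rhotE : forall x t Z, (1 <= t)%N -> bF R E Z ->
       is_iterR_cond P g0 g K x t Z (rhot (rho x) t Z))
    (drm : forall x, dynamic_conditional_risk_mapping (P x) (rho x)) :
  markovian P rho.
Proof.
case: chainP => mP P0 [Q PQ].
have P_start x := ae_coord0 (polish_measurable_set1 x polishE) (P0 x).
split=> [Z bZ|x Z t bZ].
  have [/measurable_wrtP mZ /pinfty_ex_gt0[M M0 ZM]] := bZ.
  split.
    exists M; split; first exact: num_real.
    move=> N MN x _; apply: le_trans (ltW MN).
    by apply: risk_mapping_bounded (drm x).1 bZ _ => w; exact: ZM.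
  under eq_fun do rewrite rho0E//.
  exact: (measurable_iterR mP g0_meas g_meas (leqnn K) mZ).
(* At time 0 the shift is the identity by computation, and the two sides differ only in x against
   X_0, which agree almost surely. *)
case: t => [|t].
  by apply: filterS (P_start x) => w /= ->.
have bZt : bF R E (Z \o shift t.+1).
  have [/measurable_wrtP mZ bndZ] := bZ; split.
    apply/measurable_wrtP.
    exact: measurableT_comp mZ (@measurable_shift E _).
  move: bndZ; rewrite /= /bounded_near.
  by apply: filterS => M ZM w _; exact: ZM.
have := iterR_markov mP P_start PQ g0_meas g0_compact g_meas g_compact
  (leqnn K) bZ (rhotE x t.+1 _ isT bZt).
by apply: filterS => w; rewrite /= rho0E.
Qed.
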